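(* Let $\alpha$ be the (real) stabilization parameter and $h$ the mesh size, and consider the Orthogonal Subscale Stabilized Global Flux (OSS-GF) scheme $$ \begin{aligned} 0={}&M_x\otimes M_y\,\partial_t\mathrm u+D_x\otimes M_y(\mathrm p-\mathrm K_u)+\alpha h\,Z_x\otimes D_y(\mathrm U+\mathrm V-\mathrm K_p),\\ 0={}&M_x\otimes M_y\,\partial_t\mathrm v+M_x\otimes D_y(\mathrm p-\mathrm K_v)+\alpha h\,D_x\otimes Z_y(\mathrm U+\mathrm V-\mathrm K_p),\\ 0={}&M_x\otimes M_y\,\partial_t\mathrm p+D_x\otimes D_y(\mathrm U+\mathrm V-\mathrm K_p)+\alpha h\Bigl[Z_x\otimes M_y(\mathrm p-\mathrm K_u)+M_x\otimes Z_y(\mathrm p-\mathrm K_v)\Bigr], \end{aligned} $$ where $Z_x=D^x_x-D^xM_x^{-1}D_x$, $Z_y=D^y_y-D^yM_y^{-1}D_y$, and $\mathrm U=\mathbf 1_x\otimes I_y\,\mathrm u$, $\mathrm V=I_x\otimes \mathbf 1_y\,\mathrm v$, $\mathrm K_u=I_x\otimes\mathbf 1_y\,\mathrm S_u$, $\mathrm K_v=\mathbf 1_x\otimes I_y\,\mathrm S_v$, $\mathrm K_p=I_x\otimes I_y\,\mathrm S_p$ (notation as in the context). This stabilized scheme admits the discrete steady states characterized by each of the following two conditions; that is, whenever $(\mathrm u,\mathrm v,\mathrm p)$ satisfies (A), and likewise whenever it satisfies (B), the spatial (time-derivative-free) part of each of the three equations vanishes. (A) At all nodes $(i,k;j,s)$: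 $\mathrm p_{i,k;j,s}-(\mathrm K_u)_{i,k;j,s}=\sigma^y_u(j,s)$, $\mathrm p_{i,k;j,s}-(\mathrm K_v)_{i,k;j,s}=\sigma^x_v(i,k)$, and $\mathrm U_{i,k;j,s}+\mathrm V_{i,k;j,s}-(\mathrm K_p)_{i,k;j,s}=\sigma^x_p(i,k)+\sigma^y_p(j,s)$, where $\sigma^y_u,\sigma^y_p$ are arbitrary functions of the $y$-node only and $\sigma^x_v,\sigma^x_p$ arbitrary functions of the $x$-node only. (B) For every cell $E_{ij}$ and all $s,t\in\{0,\dots,K\}$, $$ \begin{aligned} &\int_{x_{i,0}}^{x_{i,s}}\bigl(\partial_xp_h-(S_u)_h\bigr)(x,y_{j,t})\,dx=0,\qquad \int_{y_{j,0}}^{y_{j,t}}\bigl(\partial_yp_h-(S_v)_h\bigr)(x_{i,s},y)\,dy=0,\\ &\int_{x_{i,0}}^{x_{i,s}}\int_{y_{j,0}}^{y_{j,t}}\bigl(\partial_xu_h+\partial_yv_h-(S_p)_h\bigr)\,dy\,dx=0 . \end{aligned} $$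
   Context: PDE. The scheme approximates $\partial_t u+\partial_x p=S_u$, $\partial_t v+\partial_y p=S_v$, $\partial_t p+\partial_x u+\partial_y v=S_p$ on a rectangle $\Omega=[x_0,x_e]\times[y_0,y_e]$. The velocity source is $(S_u,S_v)=c(x,y)(v,-u)-f(x,y)(u,v)+\boldsymbol\tau(x,y)$ with given functions $c,f,\boldsymbol\tau$, and $S_p$ is a scalar source. Mesh and spaces. $\Omega$ is divided into uniform Cartesian cells $E_{ij}=[x_i,x_{i+1}]\times[y_j,y_{j+1}]$, $0\le i<N_x$, $0\le j<N_y$, of sizes $\Delta x,\Delta y$, and $h=\min(\Delta x,\Delta y)$. Fix a degree $K\ge 1$. Each cell $[x_i,x_{i+1}]$ carries the $K+1$ Gauss-Lobatto points $x_{i,0}=x_i<\dots<x_{i,K}=x_{i+1}$ (so the nodes $(i,0)$ and $(i-1,K)$ are identified), and similarly $y_{j,0},\dots,y_{j,K}$. Let $\varphi^x_\alpha$ be the continuous piecewise-$\mathbb P^K$ Lagrange basis at the 1D nodes in $x$, and $\varphi^y_\beta$ the one in $y$. $V_h$ is the space spanned by the products $\varphi^x_\alpha(x)\varphi^y_\beta(y)$. A function $q_h\in V_h$ is identified with its array $\mathrm q$ of nodal values, and $(A\otimes B)\mathrm q$ has entries $\sum_{\alpha',\beta'}A_{\alpha\alpha'}B_{\beta\beta'}\mathrm q_{\alpha';\beta'}$. Matrices. $(M_x)_{\alpha\beta}=\int\varphi^x_\alpha\varphi^x_\beta\,dx$, $(D_x)_{\alpha\beta}=\int\varphi^x_\alpha(\varphi^x_\beta)'\,dx$,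 $(D^x)_{\alpha\beta}=\int(\varphi^x_\alpha)'\varphi^x_\beta\,dx$, $(D^x_x)_{\alpha\beta}=\int(\varphi^x_\alpha)'(\varphi^x_\beta)'\,dx$, computed with Gauss-Lobatto quadrature at the nodes (so $M_x$ is diagonal and invertible); $M_y,D_y,D^y,D^y_y$ are defined analogously in $y$. $\mathbf 1_x,\mathbf 1_y$ are identity matrices. Integration operators. For a 1D nodal array $\mathrm q$ with interpolant $q_h$, $(I_x\mathrm q)_{i,p}=(I_x\mathrm q)_{i,0}+\int_{x_{i,0}}^{x_{i,p}}q_h(x)\,dx$, with continuity $(I_x\mathrm q)_{i,0}=(I_x\mathrm q)_{i-1,K}$ across cells and initial value $0$ at $x_0$; $I_y$ is analogous. Sources and boundary. $\mathrm S_u,\mathrm S_v,\mathrm S_p$ are the arrays of nodal values of the sources (evaluated at the nodal unknowns where they depend on them), and $(S_u)_h,(S_v)_h,(S_p)_h\in V_h$ the corresponding interpolants. The variational equations are tested with functions of $V_h$ vanishing on $\partial\Omega$ and are complemented by boundary conditions. *)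

(* Defs.v *)
(* MathComp-Analysis, over an arbitrary [R : realType]. *)
From HB Require Import structures.
From mathcomp Require Import all_boot all_order all_algebra.
From mathcomp Require Import all_classical all_reals all_analysis.
Set Implicit Arguments.
Unset Strict Implicit.
Unset Printing Implicit Defensive.
Import Order.TTheory GRing.Theory Num.Theory.
Import numFieldNormedType.Exports.
Local Open Scope classical_set_scope.
Local Open Scope ring_scope.

(* Rodrigues' formula. *)
Definition legendre (R : realType) (n : nat) : {poly R} :=
  (2 ^+ n * n`!%:R)^-1 *: (('X^2 - 1) ^+ n)^`(n).

(* The K+1 Gauss-Lobatto points of [-1, 1] in increasing order: both end
   points and the zeros of P_K'.  Since P_K' has degree K-1, these conditions
   determine [xi]. *)
Definition gauss_lobatto (R : realType) (K : nat) (xi : 'I_K.+1 -> R) : Prop :=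
  [/\ xi ord0 = -1, xi ord_max = 1,
      forall k l : 'I_K.+1, (k < l)%N -> xi k < xi l &
      forall k : 'I_K.+1, (0 < k < K)%N -> root (legendre R K)^`() (xi k)].

(* A partition of [lo, hi] into [ncell] equal cells. *)
Record mesh1 (R : realType) := Mesh1 {
  lo : R;
  hi : R;
  ncell : nat;
  lo_lt_hi : lo < hi;
  ncell_gt0 : (0 < ncell)%N }.

(* The nodes (i, K) and (i+1, 0) coincide, so that there are [ncell * K + 1]
   nodes in one dimension; arrays of nodal values are indexed by them. *)
Definition nnodes (R : realType) (K : nat) (X : mesh1 R) : nat :=
  (ncell X * K).+1.

Section OneDimension.
Variables (R : realType) (K : nat) (xi : 'I_K.+1 -> R) (X : mesh1 R).

Definition step : R := (hi X - lo X) / (ncell X)%:R.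

(* x_{i,k}, with i < ncell X. *)
Definition pt (i : nat) (k : 'I_K.+1) : R :=
  lo X + i%:R * step + (1 + xi k) / 2 * step.

Definition node (i : nat) (k : 'I_K.+1) : 'I_(nnodes K X) := inord (i * K + k).

(* A pair (cell, local index) representing a node.  A node shared by two cells
   is represented as the first node of the right one, the last node of the mesh
   as (ncell X - 1, K). *)
Definition node_cell (a : 'I_(nnodes K X)) : nat :=
  minn (a %/ K) (ncell X).-1.
Definition node_loc (a : 'I_(nnodes K X)) : 'I_K.+1 :=
  inord (a - node_cell a * K).
Definition node_pt (a : 'I_(nnodes K X)) : R := pt (node_cell a) (node_loc a).

Definition lagr (i : nat) (k : 'I_K.+1) : {poly R} :=
  \prod_(l < K.+1 | l != k) ((pt i k - pt i l)^-1 *: ('X - (pt i l)%:P)).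

(* The restriction to cell i of the continuous piecewise polynomial Lagrange
   basis function attached to node a (the sum has at most one term).  Piecewise
   polynomials are handled through their restrictions to the closed cells: the
   derivatives jump across cell interfaces, and quadrature in a cell uses the
   traces from inside that cell. *)
Definition phi (i : nat) (a : 'I_(nnodes K X)) : {poly R} :=
  \sum_(k < K.+1 | node i k == a) lagr i k.

(* Weights of the interpolatory quadrature at the nodes of cell i. *)
Definition weight (i : nat) (k : 'I_K.+1) : R :=
  \int[lebesgue_measure]_(x in `[pt i ord0, pt i ord_max]) (lagr i k).[x].

(* Composite quadrature of the piecewise polynomial with restrictions [f i]. *)
Definition quad (f : nat -> {poly R}) : R :=
  \sum_(i < ncell X) \sum_(k < K.+1) weight i k * (f i).[pt i k].

(* M_x, D_x (derivative on the trial function), D^x (derivative on the test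
   function), D^x_x, Z_x. *)
Definition Mmx : 'M[R]_(nnodes K X) :=
  \matrix_(a, b) quad (fun i => phi i a * phi i b).
Definition Dlow : 'M[R]_(nnodes K X) :=
  \matrix_(a, b) quad (fun i => phi i a * (phi i b)^`()%R).
Definition Dup : 'M[R]_(nnodes K X) :=
  \matrix_(a, b) quad (fun i => (phi i a)^`()%R * phi i b).
Definition Duplow : 'M[R]_(nnodes K X) :=
  \matrix_(a, b) quad (fun i => (phi i a)^`()%R * (phi i b)^`()%R).
Definition Zmx : 'M[R]_(nnodes K X) := Duplow - Dup *m invmx Mmx *m Dlow.

(* The restriction to cell i of the interpolant of the nodal array q. *)
Definition interp1 (q : 'I_(nnodes K X) -> R) (i : nat) : {poly R} :=
  \sum_(a < nnodes K X) q a *: phi i a.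

(* [integ_left q i] is (I_x q)_{i,0}. *)
Fixpoint integ_left (q : 'I_(nnodes K X) -> R) (i : nat) : R :=
  if i is i'.+1 then
    integ_left q i' +
    \int[lebesgue_measure]_(x in `[pt i' ord0, pt i' ord_max])
      (interp1 q i').[x]
  else 0.

Definition integ (q : 'I_(nnodes K X) -> R) (a : 'I_(nnodes K X)) : R :=
  let i := node_cell a in
  integ_left q i +
  \int[lebesgue_measure]_(x in `[pt i ord0, pt i (node_loc a)])
    (interp1 q i).[x].

(* [integ] is linear in the array; this is its matrix. *)
Definition Imx : 'M[R]_(nnodes K X) :=
  \matrix_(a, b) integ (fun c => (c == b)%:R) a.

End OneDimension.

(* Array-valued (A (x) B) q; rows are indexed by x-nodes, columns by y-nodes. *)
Definition tens (R : realType) (m n : nat) (A : 'M[R]_m) (B : 'M[R]_n)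
    (q : 'M[R]_(m, n)) : 'M[R]_(m, n) :=
  \matrix_(a, b) \sum_(a' < m) \sum_(b' < n) A a a' * B b b' * q a' b'.

(* c, f and tau are functions of (x, y); the scalar source is allowed to depend
   on (x, y) and on the unknowns (u, v, p) at that point. *)
Record source_data (R : realType) := SourceData {
  src_c : R -> R -> R;
  src_f : R -> R -> R;
  src_tau_u : R -> R -> R;
  src_tau_v : R -> R -> R;
  src_p : R -> R -> R -> R -> R -> R }.

Section TwoDimensions.
Variables (R : realType) (K : nat) (xi : 'I_K.+1 -> R) (X Y : mesh1 R).
Variables (src : source_data R) (alpha : R).

Local Notation array := ('M[R]_(nnodes K X, nnodes K Y)).
Local Notation Mx := (Mmx xi X).
Local Notation My := (Mmx xi Y).
Local Notation Dx := (Dlow xi X).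
Local Notation Dy := (Dlow xi Y).
Local Notation Zx := (Zmx xi X).
Local Notation Zy := (Zmx xi Y).
Local Notation Ix := (Imx xi X).
Local Notation Iy := (Imx xi Y).

(* The restriction to cell E_ij of the function of V_h with nodal values q. *)
Definition interp2 (q : array) (i j : nat) (x y : R) : R :=
  \sum_(a < nnodes K X) \sum_(b < nnodes K Y)
    q a b * (phi xi i a).[x] * (phi xi j b).[y].

Variables (u v p : array).

Definition Su : array := \matrix_(a, b)
  let x := node_pt xi a in let y := node_pt xi b in
  src_c src x y * v a b - src_f src x y * u a b + src_tau_u src x y.
Definition Sv : array := \matrix_(a, b)
  let x := node_pt xi a in let y := node_pt xi b in
  - (src_c src x y * u a b) - src_f src x y * v a b + src_tau_v src x y.
Definition Sp : array := \matrix_(a, b)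
  src_p src (node_pt xi a) (node_pt xi b) (u a b) (v a b) (p a b).

Definition arrU : array := tens 1%:M Iy u.
Definition arrV : array := tens Ix 1%:M v.
Definition Ku : array := tens Ix 1%:M Su.
Definition Kv : array := tens 1%:M Iy Sv.
Definition Kp : array := tens Ix Iy Sp.

Definition hmesh : R := Num.min (step X) (step Y).

(* The three equations of the scheme without (M_x (x) M_y) d/dt; every row is
   kept, including those of the boundary nodes. *)
Definition spatial_u : array :=
  tens Dx My (p - Ku) + (alpha * hmesh) *: tens Zx Dy (arrU + arrV - Kp).
Definition spatial_v : array :=
  tens Mx Dy (p - Kv) + (alpha * hmesh) *: tens Dx Zy (arrU + arrV - Kp).
Definition spatial_p : array :=
  tens Dx Dy (arrU + arrV - Kp) +
  (alpha * hmesh) *: (tens Zx My (p - Ku) + tens Mx Zy (p - Kv)).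

Definition steady_state : Prop :=
  [/\ spatial_u = 0, spatial_v = 0 & spatial_p = 0].

Definition condA : Prop :=
  exists (sigma_yu sigma_yp : 'I_(nnodes K Y) -> R)
         (sigma_xv sigma_xp : 'I_(nnodes K X) -> R),
  forall (a : 'I_(nnodes K X)) (b : 'I_(nnodes K Y)),
    [/\ p a b - Ku a b = sigma_yu b,
        p a b - Kv a b = sigma_xv a &
        arrU a b + arrV a b - Kp a b = sigma_xp a + sigma_yp b].

Definition condB : Prop :=
  forall (i : 'I_(ncell X)) (j : 'I_(ncell Y)) (s t : 'I_K.+1),
  let xs := `[pt xi X i ord0, pt xi X i s] in
  let yt := `[pt xi Y j ord0, pt xi Y j t] in
  [/\ \int[lebesgue_measure]_(x in [set` xs])
        ((fun x' => interp2 p i j x' (pt xi Y j t))^`()%classic x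
         - interp2 Su i j x (pt xi Y j t)) = 0,
      \int[lebesgue_measure]_(y in [set` yt])
        ((fun y' => interp2 p i j (pt xi X i s) y')^`()%classic y
         - interp2 Sv i j (pt xi X i s) y) = 0 &
      \int[lebesgue_measure]_(x in [set` xs])
        \int[lebesgue_measure]_(y in [set` yt])
          ((fun x' => interp2 u i j x' y)^`()%classic x
           + (fun y' => interp2 v i j x y')^`()%classic y
           - interp2 Sp i j x y) = 0].

End TwoDimensions.

(* Main.v *)
Require Import Defs.
From mathcomp Require Import all_boot all_order all_algebra.
From mathcomp Require Import all_classical all_reals all_analysis.
From mathcomp Require Import zify lra.

(** Write [A (x) B] for the operator [tens A B], that is q |-> A q B^T, and 1
    for the vector of ones.

    Condition (A) says that p - K_u has the form 1 r, p - K_v the form c 1, and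
    U + V - K_p the form c 1 + 1 r, with r a row and c a column.  The Lagrange
    basis functions sum to one in every cell ([sum_phi]), so that a matrix whose
    trial function is differentiated annihilates constants: D 1 = 0 and
    D^x_x 1 = 0, whence Z 1 = (D^x_x - D^x M^-1 D) 1 = 0.  Every term of the
    three spatial operators applies D or Z in a direction in which one summand
    of its argument is constant, and it has such a factor for each summand
    ([separable_steady]).

    Condition (B) implies condition (A).  With e^s the row s of the identity,
    the two facts about the basis that carry this are
      phi_a (x_s) = e^s_a  and
      \int_(x_0)^(x_s) phi_a = (I_x)_(s, a) - (I_x)_(0, a),
    the latter because [Imx] is made of integrals accumulated from cell to cell
    ([ipoly_phi]).  By the fundamental theorem of calculus,
    \int_(x_0)^(x_s) phi_a' = e^s_a - e^0_a.  Hence each integral of (B) of a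
    product phi_a(x) phi_b(y), with or without derivatives, is a product of
    entries of rows of the identity and of I, or of increments of such rows
    within one cell, and by bilinearity the integrals in (B) are increments of
    the discrete fields themselves: the x-increment of p - K_u, the y-increment
    of p - K_v, and the mixed increment of U + V - K_p over a sub-rectangle of
    the cell with corner (0, 0).  The first two vanish exactly when the field is
    constant along each cell in the respective direction, hence along the whole
    mesh because neighbouring cells share a node
    ([cellwise_const]); the mixed increment vanishes exactly when the field is
    a sum of a function of x and a function of y ([cellwise_separable]). *)

Set Implicit Arguments.
Unset Strict Implicit.
Unset Printing Implicit Defensive.
Import Order.TTheory GRing.Theory Num.Theory.
Import numFieldNormedType.Exports.
Local Open Scope classical_set_scope.
Local Open Scope ring_scope.

(** * Integrals of polynomials over segments *)

Section PolynomialIntegral.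
Variable R : realType.
Implicit Types (f g : {poly R}) (a b : R).

Definition ipoly a b f : R :=
  \int[lebesgue_measure]_(x in `[a, b]) f.[x].

Lemma integrable_horner a b f :
  lebesgue_measure.-integrable `[a, b] (EFin \o horner f).
Proof.
apply: continuous_compact_integrable; first exact: segment_compact.
by apply: continuous_subspaceT => x; exact: continuous_horner.
Qed.

Lemma ipolyD a b f g : ipoly a b (f + g) = ipoly a b f + ipoly a b g.
Proof.
rewrite /ipoly -RintegralD //; [|exact: integrable_horner..].
by apply: eq_Rintegral => x _; rewrite hornerD.
Qed.

Lemma ipolyZ a b c f : ipoly a b (c *: f) = c * ipoly a b f.
Proof.
rewrite /ipoly -RintegralZl //; last exact: integrable_horner.
by apply: eq_Rintegral => x _; rewrite hornerZ.
Qed.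

Lemma ipolyB a b f g : ipoly a b (f - g) = ipoly a b f - ipoly a b g.
Proof. by rewrite -scaleN1r ipolyD ipolyZ mulN1r. Qed.

Lemma ipoly_sum (I : finType) a b (c : I -> R) (f : I -> {poly R}) :
  ipoly a b (\sum_i c i *: f i) = \sum_i c i * ipoly a b (f i).
Proof.
rewrite (big_morph _ (ipolyD a b) (id1 := 0)); last first.
  by rewrite -(scale0r 0) ipolyZ mul0r.
by apply: eq_bigr => i _; rewrite ipolyZ.
Qed.

Lemma ipoly_id a f : ipoly a a f = 0.
Proof. by rewrite /ipoly set_itv1 Rintegral_set1. Qed.

Lemma ipoly_deriv a b f : a <= b -> ipoly a b f^`() = f.[b] - f.[a].
Proof.
rewrite le_eqVlt => /predU1P[<-|ab]; first by rewrite ipoly_id subrr.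
rewrite /ipoly /Rintegral (@continuous_FTC2 _ _ (horner f)) //.
- by apply: continuous_subspaceT => x; exact: continuous_horner.
- split; first by move=> x _; exact: derivable_horner.
  + by apply: cvg_at_right_filter; exact: continuous_horner.
  + by apply: cvg_at_left_filter; exact: continuous_horner.
- by move=> x _; rewrite derivE.
Qed.

End PolynomialIntegral.

(** * The bilinear form attached to a nodal array *)

Section Pairing.
Variables (R : realType) (m n : nat).
Implicit Types (q : 'M[R]_(m, n)) (r : 'I_m -> R) (s : 'I_n -> R).

(** Values, derivatives and integrals of functions of V_h, as well as entries
    of [tens A B q], are all of this form; each of those operations then acts
    on the two factors separately. *)
Definition pairing q r s : R := \sum_a \sum_b q a b * r a * s b.

Lemma eq_pairing q r r' s s' :
  r =1 r' -> s =1 s' -> pairing q r s = pairing q r' s'.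
Proof.
move=> rr' ss'; apply: eq_bigr => a _; apply: eq_bigr => b _.
by rewrite rr' ss'.
Qed.

Lemma pairingBl q r r' s :
  pairing q (fun a => r a - r' a) s = pairing q r s - pairing q r' s.
Proof.
rewrite /pairing -sumrB; apply: eq_bigr => a _; rewrite -sumrB.
by apply: eq_bigr => b _; rewrite mulrBr mulrBl.
Qed.

Lemma pairingBr q r s s' :
  pairing q r (fun b => s b - s' b) = pairing q r s - pairing q r s'.
Proof.
rewrite /pairing -sumrB; apply: eq_bigr => a _; rewrite -sumrB.
by apply: eq_bigr => b _; rewrite mulrBr.
Qed.

Lemma pairing_tens q (A : 'M[R]_m) (B : 'M[R]_n) a b :
  pairing q (A a) (B b) = tens A B q a b.
Proof.
rewrite mxE; apply: eq_bigr => a' _; apply: eq_bigr => b' _.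
by rewrite mulrC mulrA [_ * A a a']mulrC mulrA mulrC mulrA.
Qed.

Lemma pairing0 r s : pairing 0 r s = 0.
Proof.
by rewrite /pairing big1 // => a _; rewrite big1 // => b _; rewrite mxE !mul0r.
Qed.

(** The polynomial in x obtained from an element of V_h by freezing y, once the
    weights [s] are the values at y of the basis functions in y. *)
Definition slice q s (f : 'I_m -> {poly R}) : {poly R} :=
  \sum_a (\sum_b q a b * s b) *: f a.

Lemma horner_slice q s f x : (slice q s f).[x] = pairing q (horner^~ x \o f) s.
Proof.
rewrite /slice horner_sum; apply: eq_bigr => a _.
rewrite hornerZ mulr_suml; apply: eq_bigr => b _ /=.
by rewrite mulrAC.
Qed.

Lemma deriv_slice q s f :
  (slice q s f)^`()%R = slice q s (fun a => (f a)^`()%R).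
Proof. by rewrite raddf_sum; apply: eq_bigr => a _; rewrite /= derivZ. Qed.

Lemma ipoly_slice q s f x0 x1 :
  ipoly x0 x1 (slice q s f) = pairing q (ipoly x0 x1 \o f) s.
Proof.
rewrite /slice ipoly_sum; apply: eq_bigr => a _.
rewrite mulr_suml; apply: eq_bigr => b _ /=.
by rewrite mulrAC.
Qed.

End Pairing.

Lemma pairing_tr (R : realType) m n (q : 'M[R]_(m, n)) r s :
  pairing q^T s r = pairing q r s.
Proof.
rewrite /pairing exchange_big; apply: eq_bigr => a _; apply: eq_bigr => b _.
by rewrite mxE mulrAC.
Qed.

(** * Kernels of tensor products *)

Section Tens.
Variables (R : realType) (m n : nat).
Implicit Types (q : 'M[R]_(m, n)) (A : 'M[R]_m) (B : 'M[R]_n).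

Lemma tensE A B q : tens A B q = A *m q *m B^T.
Proof.
apply/matrixP => a b; rewrite !mxE exchange_big; apply: eq_bigr => b' _.
rewrite !mxE mulr_suml; apply: eq_bigr => a' _.
by rewrite mulrAC.
Qed.

Lemma tens_const_l A B (s : 'rV[R]_n) :
  A *m const_mx 1 = 0 :> 'cV[R]_m -> tens A B (const_mx 1 *m s) = 0.
Proof. by move=> A1; rewrite tensE !mulmxA A1 !mul0mx. Qed.

Lemma tens_const_r A B (s : 'cV[R]_m) :
  B *m const_mx 1 = 0 :> 'cV[R]_n -> tens A B (s *m const_mx 1) = 0.
Proof.
move=> B1; rewrite tensE -!mulmxA.
suff -> : const_mx 1 *m B^T = 0 :> 'rV[R]_n by rewrite !mulmx0.
by apply: trmx_inj; rewrite trmx_mul trmxK trmx_const B1 trmx0.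
Qed.

Lemma tens11 q : tens 1%:M 1%:M q = q.
Proof. by rewrite tensE mul1mx trmx1 mulmx1. Qed.

Lemma tensD A B q q' : tens A B (q + q') = tens A B q + tens A B q'.
Proof. by rewrite !tensE mulmxDr mulmxDl. Qed.

(** Why condition (A) suffices: each summand of a field is constant in one
    direction, and every operator applied to that field kills constants in that
    direction. *)
Lemma separable_steady (c : R) (Mx Dx Zx : 'M[R]_m) (My Dy Zy : 'M[R]_n)
    (ru rp : 'rV[R]_n) (cv cp : 'cV[R]_m) :
  Dx *m const_mx 1 = 0 :> 'cV[R]_m -> Zx *m const_mx 1 = 0 :> 'cV[R]_m ->
  Dy *m const_mx 1 = 0 :> 'cV[R]_n -> Zy *m const_mx 1 = 0 :> 'cV[R]_n ->
  let qu := const_mx 1 *m ru in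
  let qv := cv *m const_mx 1 in
  let qp := cp *m const_mx 1 + const_mx 1 *m rp in
  [/\ tens Dx My qu + c *: tens Zx Dy qp = 0,
      tens Mx Dy qv + c *: tens Dx Zy qp = 0 &
      tens Dx Dy qp + c *: (tens Zx My qu + tens Mx Zy qv) = 0].
Proof.
move=> Dx1 Zx1 Dy1 Zy1 /=; rewrite !tensD.
rewrite !(tens_const_l _ _ Dx1) !(tens_const_l _ _ Zx1).
rewrite !(tens_const_r _ _ Dy1) !(tens_const_r _ _ Zy1).
by rewrite !addr0 !scaler0 !addr0.
Qed.

End Tens.

(** * The Lagrange basis and the one-dimensional matrices *)

Section Mesh.
Variables (R : realType) (K : nat) (xi : 'I_K.+1 -> R) (X : mesh1 R).
Hypothesis K_gt0 : (0 < K)%N.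
Hypothesis xi_lt : forall k l : 'I_K.+1, (k < l)%N -> xi k < xi l.

Lemma step_gt0 : 0 < step X.
Proof.
by rewrite divr_gt0 ?ltr0n ?ncell_gt0 // subr_gt0 lo_lt_hi.
Qed.

Lemma pt_lt i (k l : 'I_K.+1) : (k < l)%N -> pt xi X i k < pt xi X i l.
Proof.
move=> kl; rewrite /pt ltrD2l ltr_pM2r ?step_gt0 // ltr_pM2r ?invr_gt0 //.
by rewrite ltrD2l xi_lt.
Qed.

Lemma pt_le i (k : 'I_K.+1) : pt xi X i ord0 <= pt xi X i k.
Proof.
have [->//|] := eqVneq k ord0; rewrite -val_eqE /= -lt0n => k0.
exact/ltW/pt_lt.
Qed.

Lemma pt_inj i : injective (pt xi X i).
Proof.
move=> k l kl; apply: val_inj.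
by case: (ltngtP k l) => // /(pt_lt i); rewrite kl ltxx.
Qed.

Lemma lagr_pt i k l : (lagr xi X i k).[pt xi X i l] = (l == k)%:R.
Proof.
rewrite /lagr horner_prod; have [->|lk] := eqVneq l k.
  apply: big1 => l' l'k; rewrite !hornerE mulVf // subr_eq0.
  by rewrite (inj_eq (@pt_inj i)) eq_sym.
by rewrite (bigD1 l) //= !hornerE subrr mulr0 mul0r.
Qed.

Lemma size_lagr i k : (size (lagr xi X i k) <= K.+1)%N.
Proof.
rewrite /lagr; apply: leq_trans (size_poly_prod_leq _ _) _.
rewrite leq_subLR cardC1 card_ord /=.
have -> : (K + K.+1 = (K * 2).+1)%N by rewrite addnS muln2 addnn.
have <- : (\sum_(l | l != k) 2 = K * 2)%N.
  by rewrite sum_nat_const cardC1 card_ord.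
rewrite ltnS; apply: leq_sum => l _.
by rewrite (leq_trans (size_scale_leq _ _)) // size_XsubC.
Qed.

(** The difference of the two sides has degree at most K and vanishes at the
    K + 1 distinct nodes. *)
Lemma sum_lagr i : \sum_k lagr xi X i k = 1.
Proof.
apply/eqP; rewrite -subr_eq0; apply/eqP.
apply: (@roots_geq_poly_eq0 _ _ [seq pt xi X i k | k : 'I_K.+1]).
- apply/allP => _ /mapP[l _ ->]; rewrite /root hornerD hornerN hornerC.
  rewrite horner_sum (bigD1 l) //= lagr_pt eqxx big1 ?addr0 ?subrr // => k kl.
  by rewrite lagr_pt eq_sym (negbTE kl).
- by rewrite map_inj_uniq ?enum_uniq //; exact: pt_inj.
- rewrite size_map size_enum_ord (leq_trans (size_polyD _ _)) //.
  rewrite geq_max size_polyN size_poly1 andbT.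
  apply: (leq_trans (size_sum _ _ _)); apply/bigmax_leqP => k _.
  exact: size_lagr.
Qed.

Lemma phi_pt i k (a : 'I_(nnodes K X)) :
  (phi xi i a).[pt xi X i k] = (node X i k == a)%:R.
Proof.
rewrite /phi horner_sum big_mkcond (bigD1 k) //= big1 ?addr0.
  by rewrite lagr_pt eqxx; case: eqP.
by move=> l lk; rewrite lagr_pt [k == l]eq_sym (negbTE lk); case: ifP.
Qed.

Lemma sum_phi i : \sum_(a < nnodes K X) phi xi i a = 1.
Proof.
rewrite -(sum_lagr i) /phi (exchange_big_dep predT) //=.
apply: eq_bigr => k _.
by rewrite (big_pred1 (node X i k)) //= => a; exact: eq_sym.
Qed.

(** The derivative of the constant function 1 is the zero polynomial in every
    cell, and so are its products with [g]; their quadrature sums vanish. *)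
Lemma quad_phi_deriv_sum (g : nat -> {poly R}) :
  \sum_(b < nnodes K X) quad xi X (fun i => g i * (phi xi i b)^`()%R) = 0.
Proof.
rewrite /quad exchange_big big1 // => i _; rewrite exchange_big big1 // => k _.
rewrite -mulr_sumr -horner_sum -mulr_sumr -raddf_sum sum_phi.
by rewrite /= -[1]polyC1 derivC mulr0 horner0 mulr0.
Qed.

Lemma Dlow_const : Dlow xi X *m const_mx 1 = 0 :> 'cV[R]_(nnodes K X).
Proof.
apply/matrixP => a b; rewrite !mxE.
rewrite -[RHS](quad_phi_deriv_sum (fun i => phi xi i a)).
by apply: eq_bigr => c _; rewrite !mxE mulr1.
Qed.

Lemma Duplow_const : Duplow xi X *m const_mx 1 = 0 :> 'cV[R]_(nnodes K X).
Proof.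
apply/matrixP => a b; rewrite !mxE.
rewrite -[RHS](quad_phi_deriv_sum (fun i => (phi xi i a)^`()%R)).
by apply: eq_bigr => c _; rewrite !mxE mulr1.
Qed.

Lemma Zmx_const : Zmx xi X *m const_mx 1 = 0 :> 'cV[R]_(nnodes K X).
Proof. by rewrite mulmxBl Duplow_const -!mulmxA Dlow_const !mulmx0 subr0. Qed.

(** * Arrays along one dimension *)

Lemma val_node i (k : 'I_K.+1) :
  (i < ncell X)%N -> node X i k = (i * K + k)%N :> nat.
Proof.
move=> iX; rewrite /node inordK // ltnS.
have -> : (ncell X = i.+1 + (ncell X - i.+1))%N by rewrite subnKC.
rewrite mulnDl mulSn; have := ltn_ord k; lia.
Qed.

Lemma node_ord_max i : node X i ord_max = node X i.+1 (ord0 : 'I_K.+1).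
Proof. by rewrite /node /= addn0 mulSn addnC. Qed.

Lemma node_cell_lt (a : 'I_(nnodes K X)) : (node_cell a < ncell X)%N.
Proof.
by rewrite /node_cell gtn_min orbC prednK ?ncell_gt0 // leqnn.
Qed.

Lemma node_cell_loc (a : 'I_(nnodes K X)) :
  node X (node_cell a) (node_loc a) = a.
Proof.
have N0 := ncell_gt0 X; have aN := ltn_ord a; rewrite /nnodes ltnS in aN.
have ca := leq_trans (leq_mul (geq_minl (a %/ K) (ncell X).-1) (leqnn K))
  (leq_trunc_div a K).
apply: val_inj; rewrite [LHS]val_node ?node_cell_lt // /node_loc inordK.
  by rewrite subnKC.
rewrite ltnS leq_subLR /node_cell.
case: (leqP (a %/ K) (ncell X).-1) => h.
  have := ltn_pmod a K_gt0; rewrite {2}(divn_eq a K); lia.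
by rewrite -[X in (_ + X)%N]mul1n -mulnDl addn1 prednK.
Qed.

Lemma node_ind (P : 'I_(nnodes K X) -> Prop) :
  (forall i k, (i < ncell X)%N -> P (node X i k)) -> forall a, P a.
Proof. by move=> H a; rewrite -(node_cell_loc a); apply/H/node_cell_lt. Qed.

(** Neighbouring cells share a node, so that the value at the first node of the
    mesh propagates from cell to cell. *)
Lemma cellwise_const (T : Type) (g : 'I_(nnodes K X) -> T) :
  (forall i k, (i < ncell X)%N -> g (node X i k) = g (node X i ord0)) ->
  forall a, g a = g ord0.
Proof.
move=> gE.
have left i : (i < ncell X)%N -> g (node X i (ord0 : 'I_K.+1)) = g ord0.
  elim: i => [|i IH] iX.
    by congr g; apply: val_inj; rewrite [LHS]val_node.
  by rewrite -node_ord_max gE ?IH // ltnW.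
by apply: node_ind => i k iX; rewrite gE ?left.
Qed.

(** [integ] is evaluated in the cell chosen by [node_cell], which for a shared
    node is the cell on its right.  Because the integral is accumulated
    continuously across cells, any cell that contains the node gives the same
    value. *)
Lemma integ_node q i k : (i < ncell X)%N ->
  integ xi q (node X i k) =
  integ_left xi q i + ipoly (pt xi X i ord0) (pt xi X i k) (interp1 xi q i).
Proof.
move=> iX; rewrite /integ -/(ipoly _ _ _).
have [kK|kK] := ltnP k K.
  have ci : node_cell (node X i k) = i.
    rewrite /node_cell (val_node _ iX) divnMDl // divn_small // addn0.
    by apply/minn_idPl; rewrite -ltnS prednK // ncell_gt0.
  by rewrite /node_loc ci (val_node _ iX) addKn inord_val.
(* Only the last local index is ambiguous: the node belongs to the next cell
   if there is one. *)
have {kK}-> : k = ord_max.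
  by apply: val_inj; apply/eqP; rewrite eqn_leq kK -ltnS ltn_ord.
have [iX'|iX'] := ltnP i.+1 (ncell X).
  have ci : node_cell (node X i (ord_max : 'I_K.+1)) = i.+1.
    rewrite /node_cell (val_node _ iX) divnMDl // divnn K_gt0 addn1.
    by apply/minn_idPl; rewrite -ltnS prednK // ncell_gt0.
  rewrite /node_loc ci (val_node _ iX) mulSn [(K + _)%N]addnC subnn.
  have -> : inord 0 = ord0 :> 'I_K.+1 by apply: val_inj; rewrite /= inordK.
  by rewrite ipoly_id addr0.
have ci : node_cell (node X i (ord_max : 'I_K.+1)) = i.
  rewrite /node_cell (val_node _ iX) divnMDl // divnn K_gt0 addn1.
  have -> : ncell X = i.+1 by apply/eqP; rewrite eqn_leq iX iX'.
  by apply/minn_idPr.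
rewrite /node_loc ci (val_node _ iX) addKn.
by rewrite (_ : inord _ = ord_max) //; apply: val_inj; rewrite /= inordK.
Qed.

(** * Integrals of the basis functions *)

Lemma interp1_delta i (b : 'I_(nnodes K X)) :
  interp1 xi (fun c => (c == b)%:R) i = phi xi i b.
Proof.
rewrite /interp1 (bigD1 b) //= eqxx scale1r big1 ?addr0 // => a ab.
by rewrite (negbTE ab) scale0r.
Qed.

Definition incr (A : 'M[R]_(nnodes K X)) i k (b : 'I_(nnodes K X)) : R :=
  A (node X i k) b - A (node X i ord0) b.

(** Column b of [Imx] integrates the b-th unit array, whose interpolant is the
    basis function of node b; the part accumulated in the previous cells
    cancels in the increment. *)
Lemma ipoly_phi i k b : (i < ncell X)%N ->
  ipoly (pt xi X i ord0) (pt xi X i k) (phi xi i b) = incr (Imx xi X) i k b.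
Proof.
move=> iX; rewrite /incr !mxE !integ_node // interp1_delta ipoly_id addr0.
by rewrite addrC addKr.
Qed.

Lemma phi_pt_mx i k (b : 'I_(nnodes K X)) :
  (phi xi i b).[pt xi X i k] = (1%:M : 'M[R]_(nnodes K X)) (node X i k) b.
Proof. by rewrite phi_pt !mxE. Qed.

Lemma ipoly_deriv_phi i k b :
  ipoly (pt xi X i ord0) (pt xi X i k) (phi xi i b)^`()%R = incr 1%:M i k b.
Proof. by rewrite ipoly_deriv ?pt_le // !phi_pt_mx. Qed.

(** One-dimensional integration of the third integrand of condition (B).  It is
    used for the inner integral as well as for the outer one. *)
Lemma integral_pairing n (q1 q2 q3 : 'M[R]_(nnodes K X, n)) s1 s2 s3 i k :
  (i < ncell X)%N ->
  \int[lebesgue_measure]_(x in `[pt xi X i ord0, pt xi X i k])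
    (pairing q1 (fun a => (phi xi i a)^`()%R.[x]) s1
     + pairing q2 (fun a => (phi xi i a).[x]) s2
     - pairing q3 (fun a => (phi xi i a).[x]) s3) =
  pairing q1 (incr 1%:M i k) s1 + pairing q2 (incr (Imx xi X) i k) s2
  - pairing q3 (incr (Imx xi X) i k) s3.
Proof.
move=> iX.
transitivity (ipoly (pt xi X i ord0) (pt xi X i k)
  (slice q1 s1 (fun a => (phi xi i a)^`()%R) + slice q2 s2 (phi xi i)
   - slice q3 s3 (phi xi i))).
  by apply: eq_Rintegral => x _; rewrite !hornerD hornerN !horner_slice.
rewrite ipolyB ipolyD !ipoly_slice.
congr (_ + _ - _); apply: eq_pairing => // a /=.
- exact: ipoly_deriv_phi.
- exact: ipoly_phi.
- exact: ipoly_phi.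
Qed.

Lemma integral_pairing2 n (q q' : 'M[R]_(nnodes K X, n)) s i k :
  (i < ncell X)%N ->
  \int[lebesgue_measure]_(x in `[pt xi X i ord0, pt xi X i k])
    (pairing q (fun a => (phi xi i a)^`()%R.[x]) s
     - pairing q' (fun a => (phi xi i a).[x]) s) =
  pairing q (incr 1%:M i k) s - pairing q' (incr (Imx xi X) i k) s.
Proof.
move=> iX; have := integral_pairing q 0 q' s s s k iX.
rewrite pairing0 addr0 => <-; apply: eq_Rintegral => x _.
by rewrite pairing0 addr0.
Qed.

End Mesh.

(** * Increments of two-dimensional arrays *)

Section Increments.
Variables (R : realType) (K : nat) (X Y : mesh1 R).
Hypothesis K_gt0 : (0 < K)%N.
Variables (q : 'M[R]_(nnodes K X, nnodes K Y)).
Variables (A : 'M[R]_(nnodes K X)) (B : 'M[R]_(nnodes K Y)).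

Lemma pairing_incrl i k b :
  pairing q (incr A i k) (B b) =
  tens A B q (node X i k) b - tens A B q (node X i ord0) b.
Proof. by rewrite pairingBl !pairing_tens. Qed.

Lemma pairing_incrr j l a :
  pairing q (A a) (incr B j l) =
  tens A B q a (node Y j l) - tens A B q a (node Y j ord0).
Proof. by rewrite pairingBr !pairing_tens. Qed.

Lemma pairing_incr i k j l :
  pairing q (incr A i k) (incr B j l) =
  (tens A B q (node X i k) (node Y j l)
   - tens A B q (node X i ord0) (node Y j l))
  - (tens A B q (node X i k) (node Y j ord0)
     - tens A B q (node X i ord0) (node Y j ord0)).
Proof. by rewrite pairingBr !pairing_incrl. Qed.

(** A vanishing mixed increment makes the y-increments independent of x; they
    determine the function up to its values on one line. *)
Lemma cellwise_separable (g : 'I_(nnodes K X) -> 'I_(nnodes K Y) -> R) :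
  (forall i k j l, (i < ncell X)%N -> (j < ncell Y)%N ->
    g (node X i k) (node Y j l) - g (node X i ord0) (node Y j l)
    = g (node X i k) (node Y j ord0) - g (node X i ord0) (node Y j ord0)) ->
  forall a b, g a b = g a ord0 - g ord0 ord0 + g ord0 b.
Proof.
move=> gE a b.
have incr_y j l : (j < ncell Y)%N ->
    g a (node Y j l) - g a (node Y j ord0) =
    g ord0 (node Y j l) - g ord0 (node Y j ord0).
  move=> jY; move: a.
  apply: (cellwise_const K_gt0) => i k iX.
  by have := gE i k j l iX jY; lra.
have /= := cellwise_const K_gt0 (g := fun b => g a b - g ord0 b) _ b.
suff H : forall j l, (j < ncell Y)%N ->
    g a (node Y j l) - g ord0 (node Y j l) =
    g a (node Y j ord0) - g ord0 (node Y j ord0) by move/(_ H); lra.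
by move=> j l /(incr_y j l); lra.
Qed.

End Increments.

(** * The steady states of the scheme *)

Section Scheme.
Variables (R : realType) (K : nat) (xi : 'I_K.+1 -> R) (X Y : mesh1 R).
Hypothesis K_gt0 : (0 < K)%N.
Hypothesis xi_lt : forall k l : 'I_K.+1, (k < l)%N -> xi k < xi l.
Variables (src : source_data R) (alpha : R).
Local Notation array := ('M[R]_(nnodes K X, nnodes K Y)).
Variables u v p : array.
Implicit Types q : array.

Lemma condA_steady_state :
  condA xi src u v p -> steady_state xi src alpha u v p.
Proof.
move=> [syu [syp [sxv [sxp sE]]]].
have addE (A B : array) a b : (A + B) a b = A a b + B a b by rewrite mxE.
have oppE (A : array) a b : (- A) a b = - A a b by rewrite mxE.
have eKu : p - Ku xi src u v = const_mx 1 *m \row_b syu b.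
  apply/matrixP => a b; have [e _ _] := sE a b.
  by rewrite addE oppE e mxE big_ord1 !mxE mul1r.
have eKv : p - Kv xi src u v = (\col_a sxv a) *m const_mx 1.
  apply/matrixP => a b; have [_ e _] := sE a b.
  by rewrite addE oppE e mxE big_ord1 !mxE mulr1.
have eKp : arrU xi u + arrV xi v - Kp xi src u v p =
    (\col_a sxp a) *m const_mx 1 + const_mx 1 *m \row_b syp b.
  apply/matrixP => a b; have [_ _ e] := sE a b.
  by rewrite !addE oppE e !mxE !big_ord1 !mxE mulr1 mul1r.
have Dx1 := Dlow_const X xi_lt; have Dy1 := Dlow_const Y xi_lt.
have Zx1 := Zmx_const X xi_lt; have Zy1 := Zmx_const Y xi_lt.
rewrite /steady_state /spatial_u /spatial_v /spatial_p eKu eKv eKp.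
exact: separable_steady.
Qed.

Lemma interp2E q i j x y :
  interp2 xi q i j x y =
  pairing q (fun a => (phi xi i a).[x]) (fun b => (phi xi j b).[y]).
Proof. by []. Qed.

Lemma derive_interp2_x q i j x y :
  (fun x' => interp2 xi q i j x' y)^`()%classic x =
  pairing q (fun a => (phi xi i a)^`()%R.[x]) (fun b => (phi xi j b).[y]).
Proof.
have -> : (fun x' => interp2 xi q i j x' y) =
    horner (slice q (fun b => (phi xi j b).[y]) (phi xi i)).
  by apply/funext => z; rewrite horner_slice.
by rewrite -derivE deriv_slice horner_slice.
Qed.

Lemma derive_interp2_y q i j x y :
  (fun y' => interp2 xi q i j x y')^`()%classic y =
  pairing q (fun a => (phi xi i a).[x]) (fun b => (phi xi j b)^`()%R.[y]).
Proof.
have -> : (fun y' => interp2 xi q i j x y') =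
    horner (slice q^T (fun a => (phi xi i a).[x]) (phi xi j)).
  by apply/funext => z; rewrite horner_slice pairing_tr.
by rewrite -derivE deriv_slice horner_slice pairing_tr.
Qed.

Lemma condB_condA : condB xi src u v p -> condA xi src u v p.
Proof.
move=> B.
pose Gu a b := p a b - Ku xi src u v a b.
pose Gv a b := p a b - Kv xi src u v a b.
pose Gp a b := arrU xi u a b + arrV xi v a b - Kp xi src u v p a b.
have phiE (Z : mesh1 R) i k : (fun a => (phi xi i a).[pt xi Z i k]) =
    (1%:M : 'M[R]_(nnodes K Z)) (node Z i k).
  by apply/funext => a; exact: phi_pt_mx.
have Gu_cell i k j l : (i < ncell X)%N -> (j < ncell Y)%N ->
    Gu (node X i k) (node Y j l) = Gu (node X i ord0) (node Y j l).
  move=> iX jY; have [+ _ _] := B (Ordinal iX) (Ordinal jY) k l.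
  under eq_Rintegral => x _ do rewrite derive_interp2_x interp2E.
  rewrite integral_pairing2 // phiE !pairing_incrl tens11 /Gu /Ku; lra.
have Gv_cell i k j l : (i < ncell X)%N -> (j < ncell Y)%N ->
    Gv (node X i k) (node Y j l) = Gv (node X i k) (node Y j ord0).
  move=> iX jY; have [_ + _] := B (Ordinal iX) (Ordinal jY) k l.
  (* Transposing the arrays turns an integral in y into an integral in the first
     direction. *)
  under eq_Rintegral => y _ do
    rewrite derive_interp2_y interp2E
      -[pairing p _ _]pairing_tr -[pairing (Sv _ _ _ _) _ _]pairing_tr.
  rewrite integral_pairing2 // !pairing_tr phiE !pairing_incrr tens11 /Gv /Kv.
  lra.
have Gp_cell i k j l : (i < ncell X)%N -> (j < ncell Y)%N ->
    Gp (node X i k) (node Y j l) - Gp (node X i ord0) (node Y j l) =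
    Gp (node X i k) (node Y j ord0) - Gp (node X i ord0) (node Y j ord0).
  move=> iX jY; have [_ _] := B (Ordinal iX) (Ordinal jY) k l.
  under eq_Rintegral => x _.
    under eq_Rintegral => y _ do
      rewrite derive_interp2_x derive_interp2_y interp2E
        -[pairing u _ _]pairing_tr -[pairing v _ _]pairing_tr
        -[pairing (Sp _ _ _ _ _) _ _]pairing_tr
        [pairing u^T _ _ + _]addrC.
    rewrite integral_pairing // !pairing_tr [pairing v _ _ + _]addrC.
    over.
  rewrite integral_pairing // !pairing_incr /Gp /arrU /arrV /Kp; lra.
exists (Gu ord0), (Gp ord0), (Gv ^~ ord0), (fun a => Gp a ord0 - Gp ord0 ord0).
move=> a b; split.
- move: b; apply: (node_ind K_gt0) => j l jY.
  by apply: (cellwise_const K_gt0 (g := Gu ^~ _)) => i k iX; exact: Gu_cell.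
- move: a; apply: (node_ind K_gt0) => i k iX.
  by apply: (cellwise_const K_gt0 (g := Gv _)) => j l jY; exact: Gv_cell.
- exact: cellwise_separable.
Qed.

End Scheme.

Theorem proposition9 (R : realType) (K : nat) (K_ge1 : (1 <= K)%N)
    (xi : 'I_K.+1 -> R) (xi_GL : gauss_lobatto xi)
    (X Y : mesh1 R) (src : source_data R) (alpha : R)
    (u v p : 'M[R]_(nnodes K X, nnodes K Y)) :
  (condA xi src u v p -> steady_state xi src alpha u v p) /\
  (condB xi src u v p -> steady_state xi src alpha u v p).
Proof.
have [_ _ xi_lt _] := xi_GL.
split; first exact: condA_steady_state.
by move=> /(condB_condA K_ge1 xi_lt); exact: condA_steady_state.
Qed.
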